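(* Let $\tilde V:\mathbb{R}^2\setminus\{0\}\to\mathbb{R}$ be a smooth radially invariant potential, i.e. $\tilde V(\lambda x)=\tilde V(x)$ for all $\lambda>0$ and $x\in\mathbb{R}^2\setminus\{0\}$. Then for every real number $E$ with $E>\max\tilde V$ there exists a length $l_E\in\mathbb{R}^+$ such that on the straight line segment from $(0,l_E)$ to $(l_E,l_E)$ in $\mathbb{R}^2$ there exists an energy eigenstate for energy $E$ of the Hamiltonian operator $$\hat H\psi=-\frac{\mathrm{d}^2}{\mathrm{d}s^2}\psi+V\cdot\psi,$$ where $V$ is the restriction of $\tilde V$ to this line segment.
   Context: Units are chosen so that $\hbar^2/(2m)=1$. The segment from $(0,l)$ to $(l,l)$ is parametrized by arc length $s\in[0,l]$, so $V(s)=\tilde V(s,l)$. The segment is a ''box'' (infinite potential walls at its ends), so wave functions on it vanish at the endpoints: an energy eigenstate for energy $E$ on the segment is a nonzero twice differentiable function $\psi:[0,l]\to\mathbb{C}$ with $-\psi''+V\psi=E\psi$ on $[0,l]$ and $\psi(0)=\psi(l)=0$. *)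

(* Defs.v *)
From Stdlib Require Import Reals.
From Coquelicot Require Import Coquelicot.
Open Scope R_scope.

(* A function on R^2 \ {0} is represented by a total function R -> R -> R whose
   value at the origin is irrelevant: nothing below depends on it. *)

Definition nonzero (x y : R) : Prop := (x, y) <> (0, 0).

(* [ex_diff_n f n x y] says that the iterated partial derivatives of [f] of
   order up to [n] exist at (x, y) and are continuous there. *)
Definition smooth (W : R -> R -> R) : Prop :=
  forall (n : nat) (x y : R), nonzero x y -> ex_diff_n W n x y.

Definition radially_invariant (W : R -> R -> R) : Prop :=
  forall lambda x y : R,
    0 < lambda -> nonzero x y -> W (lambda * x) (lambda * y) = W x y.

Definition is_maximum (W : R -> R -> R) (M : R) : Prop :=
  (exists x y : R, nonzero x y /\ W x y = M) /\
  (forall x y : R, nonzero x y -> W x y <= M).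

(* [iota] is definite description: by [maximum_eq], [maximum W] is the maximum
   of [W] on R^2 \ {0} as soon as there is one. When [W] is smooth and radially
   invariant there is one, since the unit circle is compact. *)
Definition maximum (W : R -> R -> R) : R := iota (is_maximum W).

Lemma maximum_eq (W : R -> R -> R) (M : R) :
  is_maximum W M -> maximum W = M.
Proof.
intros HM.
apply (iota_unique (V := R_CompleteNormedModule)); [|exact HM].
intros N [[x [y [Hxy <-]]] HN].
destruct HM as [[u [v [Huv <-]]] HM].
apply Rle_antisym; auto.
Qed.

Definition segment (l s : R) : Prop := 0 <= s <= l.

(* The derivative of [f] at [s] relative to [D], i.e. the limit of
   (f t - f s) / (t - s) as t tends to s in D: one-sided at the endpoints of a
   segment. It does not depend on the values of [f] outside [D]. This is
   [is_derive] with [locally s] replaced by its trace on [D]. *)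
Definition is_derive_within (D : R -> Prop) (f : R -> C) (s : R) (d : C) : Prop :=
  filterdiff (K := R_AbsRing) (U := R_NormedModule) (V := C_R_NormedModule)
    f (within D (locally s))
    (fun h : R => scal (V := C_R_NormedModule) h d).

(* [psi] is twice differentiable on [0,l] and [- psi'' + V psi = phi] there. *)
Definition is_hamiltonian (l : R) (V : R -> R) (psi phi : R -> C) : Prop :=
  exists psi1 psi2 : R -> C, forall s : R, segment l s ->
    is_derive_within (segment l) psi s (psi1 s) /\
    is_derive_within (segment l) psi1 s (psi2 s) /\
    (- psi2 s + RtoC (V s) * psi s)%C = phi s.

Definition energy_eigenstate (l : R) (V : R -> R) (E : R) (psi : R -> C) : Prop :=
  (exists s : R, segment l s /\ psi s <> RtoC 0) /\
  psi 0 = RtoC 0 /\ psi l = RtoC 0 /\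
  is_hamiltonian l V psi (fun s => (RtoC E * psi s)%C).

(* The point at arc length [s] on the segment from (0,l) to (l,l) is (s,l). *)
Definition restriction (W : R -> R -> R) (l : R) : R -> R := fun s => W s l.

(* Main.v *)
Require Import Defs.
From Stdlib Require Import Reals.
From Stdlib Require Import Lra IndefiniteDescription.
From Coquelicot Require Import Coquelicot.
Open Scope R_scope.

(* On the segment from (0,l) to (l,l) the substitution s = l t and radial
   invariance turn the eigenvalue equation into u'' = - l^2 q u on [0,1], where
   q t = E - Vt t 1 is continuous and bounded between positive constants
   independently of l. In polar coordinates u = r sin theta, u' = l r cos theta,
   the angle satisfies theta' = l (cos^2 theta + q sin^2 theta). The solution
   with theta 0 = 0 has theta 1 = 0 for l = 0, theta 1 >= l min(1, inf q), and
   theta 1 depends continuously on l; hence theta 1 = PI for some l > 0, and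
   then u vanishes at both ends. *)

(** * Monotonicity, continuity and limits on the real line *)

Lemma is_derive_continuity_pt (f : R -> R) (x d : R) :
  is_derive f x d -> continuity_pt f x.
Proof.
intros H. apply continuity_pt_filterlim.
apply (ex_derive_continuous (V := R_NormedModule)). now exists d.
Qed.

Lemma derive_nonneg_le (f df : R -> R) (a b : R) :
  a <= b ->
  (forall t, a <= t <= b -> is_derive f t (df t)) ->
  (forall t, a <= t <= b -> 0 <= df t) ->
  f a <= f b.
Proof.
intros Hab Hf Hdf.
destruct (MVT_gen f a b df) as [c [Hc Heq]];
  rewrite ?Rmin_left, ?Rmax_right in * by lra.
- intros t Ht. apply Hf. lra.
- intros t Ht. exact (is_derive_continuity_pt _ _ _ (Hf t Ht)).
- assert (0 <= df c * (b - a)) by (apply Rmult_le_pos; [now apply Hdf | lra]). lra.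
Qed.

Lemma is_derive_antiderivative (f : R -> R) (a t : R) :
  (forall s, continuous f s) -> is_derive (fun t => RInt f a t) t (f t).
Proof.
intros Hf. apply (is_derive_RInt f (fun t => RInt f a t) a); [|apply Hf].
apply filter_forall; intros s.
apply (RInt_correct (V := R_CompleteNormedModule)).
apply (ex_RInt_continuous (V := R_CompleteNormedModule)). auto.
Qed.

Lemma continuous_along (f : R -> R -> R) (x : R -> R) (t : R) :
  continuity_2d_pt f t (x t) -> continuous x t ->
  continuous (fun s => f s (x s)) t.
Proof.
intros Hf Hx.
apply (continuous_comp_2 (fun s => s) x f); [apply continuous_id | exact Hx |].
now apply continuity_2d_pt_filterlim.
Qed.

Lemma lipschitz_continuous (f : R -> R) (B : R) (x : R) :
  (forall s t, Rabs (f s - f t) <= B * Rabs (s - t)) -> continuous f x.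
Proof.
intros Hf. apply continuity_pt_filterlim. intros eps Heps.
(* [B] may be zero or negative, so [eps] is divided by [Rabs B + 1] instead. *)
assert (HB : 0 < Rabs B + 1) by (pose proof (Rabs_pos B); lra).
exists (eps / (Rabs B + 1)). split; [now apply Rdiv_lt_0_compat|].
intros y [_ Hy]. simpl in *. unfold Rdist in *.
apply Rle_lt_trans with (1 := Hf y x).
apply Rle_lt_trans with ((Rabs B + 1) * Rabs (y - x)).
- apply Rmult_le_compat_r; [apply Rabs_pos|]. pose proof (Rle_abs B). lra.
- apply Rmult_lt_compat_l with (1 := HB) in Hy.
  replace eps with ((Rabs B + 1) * (eps / (Rabs B + 1))) by (field; lra). exact Hy.
Qed.

(* [u n - 2 D / 2^n] increases and [u n + 2 D / 2^n] decreases. *)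
Lemma geometric_increments_limit (u : nat -> R) (D : R) :
  (forall n, Rabs (u (S n) - u n) <= D * (1/2) ^ n) ->
  is_lim_seq u (real (Lim_seq u)) /\
  forall n, Rabs (Lim_seq u - u n) <= 2 * D * (1/2) ^ n.
Proof.
intros Hu.
assert (H0 : is_lim_seq (fun n => (1/2) ^ n) 0)
  by (apply is_lim_seq_geom; rewrite Rabs_pos_eq; lra).
assert (HD : is_lim_seq (fun n => 2 * D * (1/2) ^ n) 0).
{ replace (Finite 0) with (Rbar_mult (2 * D) 0) by (simpl; f_equal; ring).
  now apply is_lim_seq_scal_l. }
set (v := fun n => u n - 2 * D * (1/2) ^ n).
set (w := fun n => u n + 2 * D * (1/2) ^ n).
assert (Hv : forall n, v n <= v (S n)).
{ intros n. unfold v. simpl. specialize (Hu n).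
  apply Rabs_le_between in Hu. lra. }
assert (Hw : forall n, w (S n) <= w n).
{ intros n. unfold w. simpl. specialize (Hu n).
  apply Rabs_le_between in Hu. lra. }
destruct (ex_lim_seq_adj v w Hv Hw) as [Ev _].
{ apply is_lim_seq_ext with (fun n => 2 * (2 * D * (1/2) ^ n)).
  - intros n. unfold v, w. ring.
  - replace (Finite 0) with (Rbar_mult 2 0) by (simpl; f_equal; ring).
    now apply is_lim_seq_scal_l. }
destruct Ev as [l Hl].
assert (Hul : is_lim_seq u l).
{ apply is_lim_seq_ext with (fun n => v n + 2 * D * (1/2) ^ n).
  - intros n. unfold v. ring.
  - replace l with (l + 0) by ring. now apply is_lim_seq_plus'. }
rewrite (is_lim_seq_unique _ _ Hul). split; [exact Hul|]. simpl.
assert (Hwl : is_lim_seq w l).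
{ replace l with (l + 0) by ring. now apply is_lim_seq_plus'. }
intros n. apply Rabs_le_between.
pose proof (is_lim_seq_incr_compare v l Hl Hv n) as H1.
pose proof (is_lim_seq_decr_compare w l Hwl Hw n) as H2.
unfold v in H1. unfold w in H2. lra.
Qed.

(** The function [D * exp (a * s) - (x s - y s)] has a nonnegative derivative and starts at [D], so
    it stays above [D], which is nonnegative. *)
Lemma exp_upper_bound_of_derive (x y dx dy : R -> R) (a D t : R) :
  0 <= t ->
  (forall s, 0 <= s -> is_derive x s (dx s)) ->
  (forall s, 0 <= s -> is_derive y s (dy s)) ->
  x 0 = 0 -> y 0 = 0 -> 0 <= D ->
  (forall s, 0 <= s -> dx s - dy s <= a * D * exp (a * s)) ->
  x t - y t <= D * exp (a * t).
Proof.
intros Ht Hx Hy Hx0 Hy0 HD Hd.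
enough (D * exp (a * 0) - (x 0 - y 0) <= D * exp (a * t) - (x t - y t)).
{ rewrite Hx0, Hy0, Rmult_0_r, exp_0 in H. lra. }
apply (derive_nonneg_le (fun s => D * exp (a * s) - (x s - y s))
  (fun s => a * D * exp (a * s) - (dx s - dy s)) 0 t Ht).
- intros s [Hs _].
  apply (is_derive_minus (V := R_NormedModule)
           (fun s => D * exp (a * s)) (fun s => x s - y s)).
  + auto_derive; [trivial | ring].
  + apply (is_derive_minus (V := R_NormedModule)); auto.
- intros s [Hs _]. specialize (Hd s Hs). lra.
Qed.

(** The one-sided bound, applied to both orders of [x] and [y]. It serves as the estimate of
    integrals in the norm weighted by [exp (- a t)], without any integral. *)
Lemma exp_bound_of_derive (x y dx dy : R -> R) (a D t : R) :
  0 <= t ->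
  (forall s, 0 <= s -> is_derive x s (dx s)) ->
  (forall s, 0 <= s -> is_derive y s (dy s)) ->
  x 0 = 0 -> y 0 = 0 -> 0 <= D ->
  (forall s, 0 <= s -> Rabs (dx s - dy s) <= a * D * exp (a * s)) ->
  Rabs (x t - y t) <= D * exp (a * t).
Proof.
intros Ht Hx Hy Hx0 Hy0 HD Hd.
apply Rabs_le_between'. split.
- enough (y t - x t <= D * exp (a * t)) by lra.
  apply (exp_upper_bound_of_derive y x dy dx); auto.
  intros s Hs. specialize (Hd s Hs). apply Rabs_le_between in Hd. lra.
- enough (x t - y t <= D * exp (a * t)) by lra.
  apply (exp_upper_bound_of_derive x y dx dy); auto.
  intros s Hs. specialize (Hd s Hs). apply Rabs_le_between in Hd. lra.
Qed.

(** * Picard iteration for a bounded, globally Lipschitz right-hand side *)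

Fixpoint picard (f : R -> R -> R) (n : nat) (t : R) : R :=
  match n with
  | O => 0
  | S n => RInt (fun s => f s (picard f n s)) 0 t
  end.

Section Picard.

Variables (f : R -> R -> R) (B L : R).
Hypothesis f_cont : forall t x, continuity_2d_pt f t x.
Hypothesis f_bound : forall t x, Rabs (f t x) <= B.
Hypothesis L_pos : 0 < L.
Hypothesis f_lip : forall t x y, Rabs (f t x - f t y) <= L * Rabs (x - y).

Let B_nonneg : 0 <= B.
Proof. apply Rle_trans with (2 := f_bound 0 0), Rabs_pos. Qed.

Lemma picard_continuous (n : nat) (t : R) : continuous (picard f n) t.
Proof.
revert t; induction n as [|n IH]; intros t; simpl.
- apply continuous_const.
- apply (ex_derive_continuous (V := R_NormedModule)).
  eexists. apply is_derive_antiderivative. intros s. now apply continuous_along.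
Qed.

Lemma picard_derive (n : nat) (t : R) :
  is_derive (picard f (S n)) t (f t (picard f n t)).
Proof.
simpl. apply (is_derive_antiderivative (fun s => f s (picard f n s))).
intros s. apply continuous_along; [apply f_cont | apply picard_continuous].
Qed.

Lemma picard_0 (n : nat) : picard f n 0 = 0.
Proof. destruct n; simpl; [reflexivity | apply (RInt_point (V := R_CompleteNormedModule))]. Qed.

(** The derivative of an iterate is a value of [f], hence at most [B] in absolute value. The
    constant does not depend on [n], so it passes to the limit of the iterates. *)
Lemma picard_lipschitz (n : nat) (s t : R) :
  Rabs (picard f n s - picard f n t) <= B * Rabs (s - t).
Proof.
destruct n as [|n].
- simpl. rewrite Rminus_diag, Rabs_R0.
  apply Rmult_le_pos; [exact B_nonneg | apply Rabs_pos].
- apply (bounded_variation _ (fun t => f t (picard f n t))).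
  intros r _. split; [apply picard_derive | apply f_bound].
Qed.

(* The weight [exp (2 L t)] makes the Picard operator a contraction of ratio 1/2. *)
Lemma picard_increment (n : nat) (t : R) :
  0 <= t ->
  Rabs (picard f (S n) t - picard f n t) <= B / (2 * L) * (1/2) ^ n * exp (2 * L * t).
Proof.
assert (HBL : 0 <= B / (2 * L)) by (apply Rdiv_le_0_compat; lra).
revert t. induction n as [|n IH]; intros t Ht.
- apply (exp_bound_of_derive (picard f 1) (fun _ => 0)
           (fun t => f t (picard f 0 t)) (fun _ => 0)); auto.
  + intros s _. apply picard_derive.
  + intros s _. apply (is_derive_const (V := R_NormedModule)).
  + apply picard_0.
  + simpl. lra.
  + intros s Hs. rewrite Rminus_0_r.
    (* The constant [B / (2 * L)] is chosen so that its product with the rate [2 * L] is the bound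
       [B] of [f]; the weight is at least 1. *)
    apply Rle_trans with (1 := f_bound _ _).
    replace (2 * L * (B / (2 * L) * (1/2) ^ 0)) with B by (simpl; field; lra).
    assert (1 <= exp (2 * L * s)).
    { pose proof (exp_ineq1_le (2 * L * s)).
      assert (0 <= 2 * L * s) by (apply Rmult_le_pos; lra). lra. }
    rewrite <- (Rmult_1_r B) at 1. now apply Rmult_le_compat_l.
- apply (exp_bound_of_derive _ _
           (fun t => f t (picard f (S n) t)) (fun t => f t (picard f n t))); auto;
    try (intros s _; apply picard_derive); try apply picard_0.
  + apply Rmult_le_pos; [exact HBL | apply pow_le; lra].
  (* The Lipschitz constant [L] is half the rate [2 * L] of the weight, which yields the new factor
     1/2. *)
  + intros s Hs. apply Rle_trans with (1 := f_lip _ _ _).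
    apply Rle_trans with (1 := Rmult_le_compat_l _ _ _ (Rlt_le _ _ L_pos) (IH s Hs)).
    simpl. right. field. lra.
Qed.

(** The limit [y] of the iterates is Lipschitz, so [x], the integral of [f s (y s)], has a two-sided
    derivative everywhere, also at 0. The iterates converge to both [x] and [y] at nonnegative
    times, so [x] solves the equation there. *)
Lemma picard_lindelof :
  exists x : R -> R, x 0 = 0 /\ (forall t, continuous x t) /\
    forall t, 0 <= t -> is_derive x t (f t (x t)).
Proof.
assert (HBL : 0 <= B / (2 * L)) by (apply Rdiv_le_0_compat; lra).
(* The iterates are controlled at nonnegative times only. *)
set (y := fun t => real (Lim_seq (fun n => picard f n (Rabs t)))).
assert (Hlim : forall t,
  is_lim_seq (fun n => picard f n (Rabs t)) (y t) /\
  forall n, Rabs (y t - picard f n (Rabs t))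
            <= 2 * (B / (2 * L) * exp (2 * L * Rabs t)) * (1/2) ^ n).
{ intros t. apply geometric_increments_limit.
  intros n. pose proof (picard_increment n (Rabs t) (Rabs_pos t)). lra. }
assert (Hlip : forall s t, Rabs (y s - y t) <= B * Rabs (s - t)).
{ intros s t.
  apply (is_lim_seq_le
    (fun n => Rabs (picard f n (Rabs s) - picard f n (Rabs t)))
    (fun _ => B * Rabs (s - t)) (Rabs (y s - y t)) (B * Rabs (s - t))).
  - intros n. apply Rle_trans with (1 := picard_lipschitz _ _ _).
    apply Rmult_le_compat_l; [exact B_nonneg | apply Rabs_triang_inv2].
  - apply (is_lim_seq_abs _ (y s - y t)). apply is_lim_seq_minus'; apply Hlim.
  - apply is_lim_seq_const. }
assert (Hfy : forall t, continuous (fun s => f s (y s)) t).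
{ intros t. apply continuous_along; [apply f_cont | exact (lipschitz_continuous _ _ _ Hlip)]. }
pose (x := fun t => RInt (fun s => f s (y s)) 0 t).
assert (Hx : forall t, is_derive x t (f t (y t))).
{ intros t. now apply (is_derive_antiderivative (fun s => f s (y s))). }
assert (Hx0 : x 0 = 0) by apply (RInt_point (V := R_CompleteNormedModule)).
exists x. split; [|split].
- exact Hx0.
- intros t. apply (ex_derive_continuous (V := R_NormedModule)). eexists. apply Hx.
(* The equation for [x] involves [y]; it becomes an equation in [x] alone once the two limits are
   identified. *)
- intros t Ht. enough (Hxy : y t = x t) by (rewrite <- Hxy; apply Hx).
  assert (Hd : forall n,
    Rabs (picard f (S n) t - x t) <= B / (2 * L) * (1/2) ^ n * exp (2 * L * t)).
  { intros n.
    apply (exp_bound_of_derive _ _ (fun t => f t (picard f n t)) (fun t => f t (y t))); auto.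
    - intros s _. apply picard_derive.
    - apply picard_0.
    - apply Rmult_le_pos; [exact HBL | apply pow_le; lra].
    - intros s Hs. apply Rle_trans with (1 := f_lip _ _ _).
      (* Multiplied by [L], the distance from [y] to the [n]-th iterate is exactly the admissible
         rate, with [a = 2 * L] and [D = B / (2 * L) * (1/2) ^ n]. *)
      destruct (Hlim s) as [_ H]. specialize (H n).
      rewrite Rabs_minus_sym in H. rewrite (Rabs_pos_eq s Hs) in H.
      apply Rle_trans with (1 := Rmult_le_compat_l _ _ _ (Rlt_le _ _ L_pos) H).
      right. ring. }
  destruct (Hlim t) as [Hy _]. rewrite (Rabs_pos_eq t Ht) in Hy.
  apply is_lim_seq_incr_1, is_lim_seq_unique in Hy.
  assert (Hx' : is_lim_seq (fun n => picard f (S n) t) (x t)).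
  { apply is_lim_seq_ext with (fun n => x t + (picard f (S n) t - x t)); [intros n; ring|].
    replace (Finite (x t)) with (Finite (x t + 0)) by (f_equal; ring).
    apply is_lim_seq_plus'; [apply is_lim_seq_const|].
    apply is_lim_seq_abs_0.
    apply is_lim_seq_le_le with (fun _ => 0)
      (fun n => B / (2 * L) * exp (2 * L * t) * (1/2) ^ n).
    - intros n. split; [apply Rabs_pos|]. specialize (Hd n). lra.
    - apply is_lim_seq_const.
    - replace (Finite 0) with (Rbar_mult (B / (2 * L) * exp (2 * L * t)) 0)
        by (simpl; f_equal; ring).
      apply is_lim_seq_scal_l, is_lim_seq_geom. rewrite Rabs_pos_eq; lra. }
  apply is_lim_seq_unique in Hx'. congruence.
Qed.

End Picard.

(** * Continuous dependence of solutions on a factor of the right-hand side *)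

(* Gronwall: [((x - y)^2 + d) exp (- a t)] decreases, with [d] and [a] the
   constants of the bound. *)
Lemma dependence_on_factor (f : R -> R -> R) (B L k l : R) (x y : R -> R) :
  0 <= L ->
  (forall t u, Rabs (f t u) <= B) ->
  (forall t u v, Rabs (f t u - f t v) <= L * Rabs (u - v)) ->
  x 0 = y 0 ->
  (forall t, 0 <= t -> is_derive x t (k * f t (x t))) ->
  (forall t, 0 <= t -> is_derive y t (l * f t (y t))) ->
  forall t, 0 <= t ->
  (x t - y t) ^ 2 <= ((k - l) * B) ^ 2 * exp ((2 * Rabs k * L + 1) * t).
Proof.
intros HL Hb Hl H0 Hx Hy t Ht.
set (a := 2 * Rabs k * L + 1). set (d := ((k - l) * B) ^ 2).
assert (Hd : 0 <= d) by (unfold d; apply pow2_ge_0).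
(* The sign is reversed to obtain an increasing function. *)
assert (Hle : - ((x 0 - y 0) ^ 2 + d) * exp (- a * 0)
              <= - ((x t - y t) ^ 2 + d) * exp (- a * t)).
{ apply (derive_nonneg_le
    (fun t => - ((x t - y t) ^ 2 + d) * exp (- a * t))
    (fun t => (a * ((x t - y t) ^ 2 + d)
       - 2 * (x t - y t) * (k * f t (x t) - l * f t (y t))) * exp (- a * t)) 0 t Ht).
  - intros s [Hs _]. pose proof (Hx s Hs). pose proof (Hy s Hs).
    auto_derive.
    + repeat split; eexists; eassumption.
    + rewrite (is_derive_unique (fun r : R => x r) _ _ (Hx s Hs)),
        (is_derive_unique (fun r : R => y r) _ _ (Hy s Hs)). ring.
  - intros s _. apply Rmult_le_pos; [|apply Rlt_le, exp_pos].
    specialize (Hl s (x s) (y s)). specialize (Hb s (y s)).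
    set (u := x s - y s) in *. set (p := f s (x s)) in *. set (r := f s (y s)) in *.
    (* The derivative of [u] is [k * p - l * r = k * (p - r) + (k - l) * r]. The Lipschitz condition
       controls the first term; the square in [H3] bounds twice the product of [u] with the second
       by [u ^ 2 + d]. *)
    assert (H1 : u * (k * (p - r)) <= Rabs k * L * u ^ 2).
    { apply Rle_trans with (1 := Rle_abs _). rewrite !Rabs_mult.
      rewrite <- (pow2_abs u).
      replace (Rabs k * L * Rabs u ^ 2) with (Rabs u * (Rabs k * (L * Rabs u))) by ring.
      apply Rmult_le_compat_l; [apply Rabs_pos|].
      apply Rmult_le_compat_l; [apply Rabs_pos | exact Hl]. }
    assert (H2 : ((k - l) * r) ^ 2 <= d).
    { unfold d. rewrite !Rpow_mult_distr. apply Rmult_le_compat_l; [apply pow2_ge_0|].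
      rewrite <- (pow2_abs r). apply pow_incr. split; [apply Rabs_pos | exact Hb]. }
    pose proof (pow2_ge_0 (u - (k - l) * r)) as H3.
    assert (H4 : 0 <= Rabs k * L * d).
    { apply Rmult_le_pos; [apply Rmult_le_pos; [apply Rabs_pos | exact HL] | exact Hd]. }
    unfold a. nra. }
rewrite H0, Rminus_diag, Rmult_0_r, exp_0 in Hle.
pose proof (exp_pos (a * t)) as He.
assert (Hee : exp (- a * t) * exp (a * t) = 1).
{ rewrite <- exp_plus, <- exp_0. f_equal. ring. }
apply (Rmult_le_compat_r _ _ _ (Rlt_le _ _ He)) in Hle.
replace (- ((x t - y t) ^ 2 + d) * exp (- a * t) * exp (a * t))
  with (- ((x t - y t) ^ 2 + d)) in Hle by (rewrite Rmult_assoc, Hee; ring).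
simpl in Hle |- *. lra.
Qed.

(** * Extrema of continuous radially invariant functions *)

Definition continuous_off_origin (W : R -> R -> R) : Prop :=
  forall x y, Defs.nonzero x y -> continuity_2d_pt W x y.

Lemma nonzero_l (x y : R) : x <> 0 -> Defs.nonzero x y.
Proof. intros Hx [=]. contradiction. Qed.

Lemma nonzero_r (x y : R) : y <> 0 -> Defs.nonzero x y.
Proof. intros Hy [=]. contradiction. Qed.

Lemma continuity_2d_pt_swap (W : R -> R -> R) (x y : R) :
  continuity_2d_pt W x y -> continuity_2d_pt (fun u v => W v u) y x.
Proof.
intros H eps. destruct (H eps) as [d Hd]. exists d. intros u v Hu Hv. now apply Hd.
Qed.

Lemma continuous_horizontal (W : R -> R -> R) (x y : R) :
  continuity_2d_pt W x y -> continuous (fun t => W t y) x.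
Proof.
intros H. apply (continuous_comp_2 (fun t => t) (fun _ => y) W).
- apply continuous_id.
- apply continuous_const.
- now apply continuity_2d_pt_filterlim.
Qed.

Lemma horizontal_side_maximum (W : R -> R -> R) (c : R) :
  continuous_off_origin W -> c <> 0 ->
  exists t, forall s, -1 <= s <= 1 -> W s c <= W t c.
Proof.
intros HW Hc.
destruct (continuity_ab_maj (fun t => W t c) (-1) 1) as [t [Ht _]].
- lra.
- intros s _. apply continuity_pt_filterlim, continuous_horizontal, HW. now apply nonzero_r.
- now exists t.
Qed.

Lemma vertical_side_maximum (W : R -> R -> R) (c : R) :
  continuous_off_origin W -> c <> 0 ->
  exists t, forall s, -1 <= s <= 1 -> W c s <= W c t.
Proof.
intros HW Hc.
apply (horizontal_side_maximum (fun u v => W v u)); [|exact Hc].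
intros x y Hxy. apply continuity_2d_pt_swap, HW.
intros [=]. subst. now apply Hxy.
Qed.

Lemma radial_projection (W : R -> R -> R) (r x y : R) :
  radially_invariant W -> Defs.nonzero x y -> 0 < r -> W x y = W (x / r) (y / r).
Proof.
intros HW Hxy Hr. rewrite <- (HW (/ r) x y); [|now apply Rinv_0_lt_compat|exact Hxy].
f_equal; unfold Rdiv; ring.
Qed.

(* Every ray from the origin meets the boundary of the square [-1,1]^2. *)
Lemma radial_maximum (W : R -> R -> R) :
  continuous_off_origin W -> radially_invariant W -> exists M, is_maximum W M.
Proof.
intros Hc Hr.
destruct (horizontal_side_maximum W 1 Hc) as [t1 H1]; [lra|].
destruct (horizontal_side_maximum W (-1) Hc) as [t2 H2]; [lra|].
destruct (vertical_side_maximum W 1 Hc) as [t3 H3]; [lra|].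
destruct (vertical_side_maximum W (-1) Hc) as [t4 H4]; [lra|].
set (M := Rmax (Rmax (W t1 1) (W t2 (-1))) (Rmax (W 1 t3) (W (-1) t4))).
exists M. split.
- unfold M. repeat apply Rmax_case.
  + exists t1, 1. split; [apply nonzero_r; lra | reflexivity].
  + exists t2, (-1). split; [apply nonzero_r; lra | reflexivity].
  + exists 1, t3. split; [apply nonzero_l; lra | reflexivity].
  + exists (-1), t4. split; [apply nonzero_l; lra | reflexivity].
- assert (W t1 1 <= M /\ W t2 (-1) <= M /\ W 1 t3 <= M /\ W (-1) t4 <= M)
    as (M1 & M2 & M3 & M4).
  { unfold M. repeat split.
    - apply Rle_trans with (2 := Rmax_l _ _), Rmax_l.
    - apply Rle_trans with (2 := Rmax_l _ _), Rmax_r.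
    - apply Rle_trans with (2 := Rmax_r _ _), Rmax_l.
    - apply Rle_trans with (2 := Rmax_r _ _), Rmax_r. }
  intros x y Hxy.
  assert (Hdiv : forall u r, 0 < r -> Rabs u <= r -> -1 <= u / r <= 1).
  { intros u r Hpos Hu. apply Rabs_le_between in Hu.
    split; [apply Rle_div_r | apply Rle_div_l]; lra. }
  assert (Hxy' : x <> 0 \/ y <> 0).
  { destruct (Req_dec x 0) as [-> |]; [|now left].
    destruct (Req_dec y 0) as [-> |]; [now destruct Hxy | now right]. }
  (* Dividing by the larger of [Rabs x] and [Rabs y] moves the point to a horizontal or a vertical
     side of the square; the sign of that coordinate decides which of the two. *)
  destruct (Rle_or_lt (Rabs x) (Rabs y)) as [Hle|Hlt].
  + assert (Hy : y <> 0).
    { intros ->. rewrite Rabs_R0 in Hle.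
      destruct Hxy' as [Hx|Hy]; [|now apply Hy].
      apply Rabs_pos_lt in Hx. lra. }
    pose proof (Rabs_pos_lt y Hy) as Hpos.
    rewrite (radial_projection W (Rabs y)); auto.
    specialize (Hdiv x (Rabs y) Hpos Hle).
    destruct (Rle_or_lt 0 y) as [Hs|Hs].
    * replace (y / Rabs y) with 1 by (rewrite Rabs_pos_eq by lra; field; lra).
      apply Rle_trans with (2 := M1). now apply H1.
    * replace (y / Rabs y) with (-1) by (rewrite Rabs_left by lra; field; lra).
      apply Rle_trans with (2 := M2). now apply H2.
  + assert (Hpos : 0 < Rabs x) by (pose proof (Rabs_pos y); lra).
    rewrite (radial_projection W (Rabs x)); auto.
    specialize (Hdiv y (Rabs x) Hpos (Rlt_le _ _ Hlt)).
    destruct (Rle_or_lt 0 x) as [Hs|Hs].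
    * rewrite Rabs_pos_eq in * by lra.
      replace (x / x) with 1 by (field; lra).
      apply Rle_trans with (2 := M3). now apply H3.
    * rewrite (Rabs_left x) in * by lra.
      replace (x / - x) with (-1) by (field; lra).
      apply Rle_trans with (2 := M4). now apply H4.
Qed.

(** Minus the maximum of [- W]. It provides the upper bound of [q], hence the Lipschitz constant of
    the angle equation. *)
Lemma radial_minorant (W : R -> R -> R) :
  continuous_off_origin W -> radially_invariant W ->
  exists m, forall x y, Defs.nonzero x y -> m <= W x y.
Proof.
intros Hc Hr.
destruct (radial_maximum (fun x y => - W x y)) as [M [_ HM]].
- intros x y Hxy eps. destruct (Hc x y Hxy eps) as [d Hd]. exists d.
  intros u v Hu Hv.
  replace (- W u v - - W x y) with (- (W u v - W x y)) by ring.
  rewrite Rabs_Ropp. now apply Hd.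
- intros l x y Hl Hxy. now rewrite Hr.
- exists (- M). intros x y Hxy. specialize (HM x y Hxy). lra.
Qed.

(** * From real derivatives to complex derivatives within a segment *)

(** Chain rule: [RtoC] is linear over the reals, hence its own differential, and differentiability
    at [s] persists along the smaller neighbourhoods in the segment. *)
Lemma is_derive_within_RtoC (l s d : R) (f : R -> R) :
  segment l s -> is_derive f s d ->
  is_derive_within (segment l) (fun t => RtoC (f t)) s (RtoC d).
Proof.
intros Hs Hf.
(* Every set of the trace filter contains [s], since [s] lies in the segment. *)
assert (HF : ProperFilter (within (segment l) (locally s))).
{ split; [|apply within_filter, locally_filter].
  intros P HP. exists s. apply (locally_singleton _ _ HP Hs). }
assert (Hlin : is_linear (K := R_AbsRing) (U := R_NormedModule)
                 (V := C_R_NormedModule) RtoC).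
{ apply (is_linear_prod (K := R_AbsRing) (T := R_NormedModule)
    (U := R_NormedModule) (V := R_NormedModule) (fun x => x) (fun _ => 0)).
  - apply is_linear_id.
  - apply (is_linear_zero (U := R_NormedModule) (V := R_NormedModule)). }
unfold is_derive_within.
apply filterdiff_ext_lin with (fun h : R => RtoC (scal h d)).
- apply (filterdiff_comp (V := R_NormedModule) (W := C_R_NormedModule)).
  + apply filterdiff_locally with s; [ | exact Hf].
    intros P HP. apply filter_le_within. exact HP.
  + now apply filterdiff_linear.
- intros h. apply injective_projections; simpl.
  + reflexivity.
  + symmetry. apply Rmult_0_r.
Qed.

(** * The Pruefer angle and the Dirichlet problem *)

(** This is cos^2 a + q sin^2 a, arranged so that [a] enters through sin^2 only. The length stays
    outside as a factor, the parameter that is varied. *)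
Definition angular_velocity (q : R -> R) (t a : R) : R := 1 + (q t - 1) * sin a ^ 2.

Section Pruefer.

Variables (q : R -> R) (m M : R).
Hypothesis q_cont : forall t, continuous q t.
Hypothesis m_pos : 0 < m.
Hypothesis q_bounds : forall t, m <= q t <= M.

Lemma angular_velocity_continuous (t a : R) :
  continuity_2d_pt (angular_velocity q) t a.
Proof.
unfold angular_velocity.
apply continuity_2d_pt_plus; [apply continuity_2d_pt_const|].
apply continuity_2d_pt_mult.
- apply (continuity_1d_2d_pt_comp (fun t => q t - 1) (fun t _ => t)).
  + apply continuity_pt_minus.
    * apply continuity_pt_filterlim, q_cont.
    * now apply continuity_pt_const.
  + apply continuity_2d_pt_id1.
- apply (continuity_1d_2d_pt_comp (fun a => sin a ^ 2) (fun _ a => a)).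
  + apply (is_derive_continuity_pt _ _ (2 * sin a * cos a)). auto_derive; [trivial | ring].
  + apply continuity_2d_pt_id2.
Qed.

(** A convex combination of 1 and [q t], with weights cos^2 a and sin^2 a. *)
Lemma angular_velocity_bounds (t a : R) :
  Rmin 1 m <= angular_velocity q t a <= Rmax 1 M.
Proof.
pose proof (sin2_cos2 a) as H. unfold Rsqr in H.
pose proof (Rle_0_sqr (sin a)) as Hs. pose proof (Rle_0_sqr (cos a)) as Hc.
unfold Rsqr in *. destruct (q_bounds t) as [Hm HM].
pose proof (Rmin_l 1 m). pose proof (Rmin_r 1 m).
pose proof (Rmax_l 1 M). pose proof (Rmax_r 1 M).
replace (angular_velocity q t a) with (cos a * cos a + q t * (sin a * sin a))
  by (unfold angular_velocity; nra).
split; nra.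
Qed.

Lemma angular_velocity_bound (t a : R) : Rabs (angular_velocity q t a) <= Rmax 1 M.
Proof.
rewrite Rabs_pos_eq; [apply angular_velocity_bounds|].
apply Rle_trans with (2 := proj1 (angular_velocity_bounds t a)).
apply Rmin_glb; lra.
Qed.

(** The derivative of sin^2 is sin (2 a), bounded by 1. *)
Lemma sin_sqr_lipschitz (a b : R) : Rabs (sin a ^ 2 - sin b ^ 2) <= Rabs (a - b).
Proof.
rewrite <- (Rmult_1_l (Rabs (a - b))).
apply (bounded_variation (fun a => sin a ^ 2) (fun a => sin (2 * a))).
intros t _. split.
- rewrite sin_2a. auto_derive; [trivial | ring].
- apply Rabs_le. apply SIN_bound.
Qed.

Lemma angular_velocity_lipschitz (t a b : R) :
  Rabs (angular_velocity q t a - angular_velocity q t b) <= (1 + M) * Rabs (a - b).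
Proof.
unfold angular_velocity.
replace (1 + (q t - 1) * sin a ^ 2 - (1 + (q t - 1) * sin b ^ 2))
  with ((q t - 1) * (sin a ^ 2 - sin b ^ 2)) by ring.
rewrite Rabs_mult. destruct (q_bounds t).
apply Rmult_le_compat; try apply Rabs_pos.
- apply Rabs_le. lra.
- apply sin_sqr_lipschitz.
Qed.

Lemma M_pos : 0 < M.
Proof. destruct (q_bounds 0). lra. Qed.

Lemma pruefer_solution (k : R) :
  exists theta : R -> R, theta 0 = 0 /\ (forall t, continuous theta t) /\
    forall t, 0 <= t -> is_derive theta t (k * angular_velocity q t (theta t)).
Proof.
pose proof M_pos. pose proof (Rabs_pos k).
(* The Lipschitz constant has [1 + Rabs k] in place of [Rabs k] to be positive even for [k = 0]. *)
apply (picard_lindelof (fun t a => k * angular_velocity q t a)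
         (Rabs k * Rmax 1 M) ((1 + Rabs k) * (1 + M))).
- intros t a. apply continuity_2d_pt_mult.
  + apply continuity_2d_pt_const.
  + apply angular_velocity_continuous.
- intros t a. rewrite Rabs_mult.
  apply Rmult_le_compat_l; [lra | apply angular_velocity_bound].
- apply Rmult_lt_0_compat; lra.
- intros t a b. rewrite <- Rmult_minus_distr_l, Rabs_mult, Rmult_assoc.
  apply Rmult_le_compat; try apply Rabs_pos; [lra | apply angular_velocity_lipschitz].
Qed.

Lemma pruefer_angle_pi :
  exists (k : R) (theta : R -> R), 0 < k /\ theta 0 = 0 /\ theta 1 = PI /\
    (forall t, continuous theta t) /\
    forall t, 0 <= t -> is_derive theta t (k * angular_velocity q t (theta t)).
Proof.
(* One solution is chosen for each [k]. The dependence estimate holds for any choice, so the final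
   angle is continuous in [k]. *)
destruct (functional_choice _ pruefer_solution) as [theta Htheta].
assert (Hcont : continuity (fun k => theta k 1)).
{ intros k. apply continuity_pt_filterlim. intros P [eps HP].
  (* The dependence estimate bounds a square, so its square root halves the exponent. That exponent
     involves [k] but not [l], so [C] serves for all [l] at once. *)
  set (C := Rmax 1 M * exp ((2 * Rabs k * (1 + M) + 1) / 2)).
  assert (HC : 0 < C).
  { apply Rmult_lt_0_compat; [|apply exp_pos]. pose proof (Rmax_l 1 M). lra. }
  assert (Hd : 0 < eps / C) by (apply Rdiv_lt_0_compat; [apply cond_pos | exact HC]).
  exists (mkposreal _ Hd). intros l Hl. apply HP.
  change (Rabs (l - k) < eps / C) in Hl.
  change (Rabs (theta l 1 - theta k 1) < eps).
  apply Rle_lt_trans with (C * Rabs (l - k)).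
  - destruct (Htheta k) as (Hk0 & _ & Hk). destruct (Htheta l) as (Hl0 & _ & Hl').
    pose proof M_pos.
    pose proof (dependence_on_factor (angular_velocity q) (Rmax 1 M) (1 + M) k l
      (theta k) (theta l)) as Hdep.
    rewrite <- (Rabs_pos_eq C) by lra. rewrite <- Rabs_mult, (Rabs_minus_sym (theta l 1)).
    apply Rsqr_le_abs_0. rewrite !Rsqr_pow2.
    replace ((C * (l - k)) ^ 2)
      with (((k - l) * Rmax 1 M) ^ 2 * exp ((2 * Rabs k * (1 + M) + 1) * 1)).
    + apply Hdep; try lra.
      * apply angular_velocity_bound.
      * apply angular_velocity_lipschitz.
      * exact Hk.
      * exact Hl'.
    + unfold C.
      replace ((2 * Rabs k * (1 + M) + 1) * 1) with
        ((2 * Rabs k * (1 + M) + 1) / 2 + (2 * Rabs k * (1 + M) + 1) / 2) by field.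
      rewrite exp_plus. ring.
  - apply (Rmult_lt_compat_l C) in Hl; [|exact HC].
    replace (C * (eps / C)) with (pos eps) in Hl by (field; lra). exact Hl. }
(* By the mean value theorem, [v] is a value of the angular velocity. The final angle is thus 0 for
   [k = 0] and at least [PI] for [k = PI / Rmin 1 m]. *)
assert (Hmean : forall k, exists v, Rmin 1 m <= v /\ theta k 1 = k * v).
{ intros k. destruct (Htheta k) as (Hk0 & _ & Hk).
  destruct (MVT_gen (theta k) 0 1 (fun t => k * angular_velocity q t (theta k t)))
    as [c [_ Hc]]; rewrite ?Rmin_left, ?Rmax_right in * by lra.
  - intros t Ht. apply Hk. lra.
  - intros t Ht. exact (is_derive_continuity_pt _ _ _ (Hk t (proj1 Ht))).
  - exists (angular_velocity q c (theta k c)).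
    split; [apply angular_velocity_bounds | lra]. }
assert (Hc : 0 < Rmin 1 m) by (apply Rmin_glb_lt; lra).
pose proof PI_RGT_0 as Hpi.
destruct (Hmean 0) as [v0 [_ H0]]. destruct (Hmean (PI / Rmin 1 m)) as [v1 [Hv1 H1]].
assert (Hbig : PI <= theta (PI / Rmin 1 m) 1).
{ rewrite H1. replace PI with (PI / Rmin 1 m * Rmin 1 m) at 1 by (field; lra).
  apply Rmult_le_compat_l; [|exact Hv1]. now apply Rlt_le, Rdiv_lt_0_compat. }
destruct (IVT_gen (fun k => theta k 1) 0 (PI / Rmin 1 m) PI Hcont) as [k [Hk Hkpi]].
{ rewrite Rmin_left, Rmax_right; lra. }
assert (0 < PI / Rmin 1 m) by now apply Rdiv_lt_0_compat.
rewrite Rmin_left, Rmax_right in Hk by lra.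
destruct (Htheta k) as (Hk0 & Hkc & Hkd).
exists k, (theta k). repeat (split; auto).
(* For [k = 0] the final angle would be 0, not [PI]. *)
destruct (Req_dec k 0) as [-> |]; lra.
Qed.

Lemma dirichlet_solution :
  exists (l : R) (u u1 : R -> R), 0 < l /\ u 0 = 0 /\ u l = 0 /\
    (exists s, segment l s /\ u s <> 0) /\
    forall s, segment l s -> is_derive u s (u1 s) /\ is_derive u1 s (- q (s / l) * u s).
Proof.
destruct pruefer_angle_pi as (l & theta & Hl & H0 & Hpi & Hcont & Hd).
(* The logarithmic derivative of the radius, forced by requiring that r sin theta have derivative l
   r cos theta. The radius [r] below is an exponential, so it never vanishes. *)
set (g := fun t => l * (1 - q t) * (sin (theta t) * cos (theta t))).
assert (Hg : forall t, continuous g t).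
{ intros t. unfold g.
  apply (continuous_mult (fun t => l * (1 - q t)) (fun t => sin (theta t) * cos (theta t))).
  - apply (continuous_mult (fun _ => l)); [apply continuous_const|].
    apply (continuous_minus (V := R_NormedModule)); [apply continuous_const | apply q_cont].
  - apply (continuous_mult (fun t => sin (theta t))).
    + apply (continuous_comp theta sin); [apply Hcont | apply continuous_sin].
    + apply (continuous_comp theta cos); [apply Hcont | apply continuous_cos]. }
set (r := fun t => exp (RInt g 0 t)).
assert (Hr : forall t, is_derive r t (r t * g t)).
{ intros t. unfold r.
  replace (exp (RInt g 0 t) * g t) with (scal (g t) (exp (RInt g 0 t)))
    by apply Rmult_comm.
  apply (is_derive_comp (V := R_NormedModule) exp (fun t => RInt g 0 t)).
  - apply is_derive_exp.
  - now apply is_derive_antiderivative. }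
exists l, (fun s => r (s / l) * sin (theta (s / l))),
  (fun s => r (s / l) * cos (theta (s / l))).
split; [exact Hl|]. split; [|split; [|split]].
- unfold Rdiv. rewrite Rmult_0_l, H0, sin_0. ring.
- rewrite Rdiv_diag, Hpi, sin_PI by lra. ring.
(* The angle passes through [PI / 2], where [u] equals the positive radius. *)
- pose proof PI_RGT_0.
  destruct (IVT_gen theta 0 1 (PI / 2)) as [t [Ht Htpi]].
  + intros t. apply continuity_pt_filterlim, Hcont.
  + rewrite H0, Hpi, Rmin_left, Rmax_right; lra.
  + rewrite Rmin_left, Rmax_right in Ht by lra.
    exists (l * t). replace (l * t / l) with t by (field; lra). split.
    * unfold segment. nra.
    * rewrite Htpi, sin_PI2, Rmult_1_r. apply Rgt_not_eq, exp_pos.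
- intros s [Hs _].
  assert (Ht : 0 <= s / l) by (apply Rdiv_le_0_compat; lra).
  specialize (Hd _ Ht). specialize (Hr (s / l)).
  pose proof (sin2_cos2 (theta (s / l))) as Hsc. rewrite !Rsqr_pow2 in Hsc.
  split; auto_derive.
  + split; [now exists (r (s / l) * g (s / l))|]. split; [|lra].
    eexists; exact Hd.
  + change (s * / l) with (s / l).
    rewrite (is_derive_unique (fun a : R => theta a) _ _ Hd),
      (is_derive_unique (fun a : R => r a) _ _ Hr).
    unfold g, angular_velocity. field. lra.
  + split; [now exists (r (s / l) * g (s / l))|]. split; [|lra].
    eexists; exact Hd.
  + change (s * / l) with (s / l).
    rewrite (is_derive_unique (fun a : R => theta a) _ _ Hd),
      (is_derive_unique (fun a : R => r a) _ _ Hr).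
    unfold g, angular_velocity.
    (* Isolating sin^2 + cos^2 lets [Hsc] reduce the bracket to [- q (s / l)]. *)
    transitivity (r (s / l) * sin (theta (s / l)) *
      ((1 - q (s / l)) * (sin (theta (s / l)) ^ 2 + cos (theta (s / l)) ^ 2) - 1)).
    * field. lra.
    * rewrite Hsc. ring.
Qed.

End Pruefer.

(** * Rescaling the potential to the segment *)

Theorem theorem1p2 :
  forall Vt : R -> R -> R,
    smooth Vt -> radially_invariant Vt ->
    forall E : R, E > maximum Vt ->
    exists l : R, 0 < l /\
      exists psi : R -> C, energy_eigenstate l (restriction Vt l) E psi.
Proof.
intros Vt Hsmooth Hrad E HE.
(* Order 0 of [ex_diff_n] is continuity at the point. *)
assert (Hc : continuous_off_origin Vt) by (intros x y Hxy; apply (Hsmooth 0%nat x y Hxy)).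
destruct (radial_maximum Vt Hc Hrad) as [M HM].
rewrite (maximum_eq Vt M HM) in HE.
destruct (radial_minorant Vt Hc Hrad) as [m Hm].
assert (Hnz : forall t, Defs.nonzero t 1) by (intros t; apply nonzero_r; lra).
(* The lower bound [E - M] is positive exactly because [E] exceeds the maximum. *)
destruct (dirichlet_solution (fun t => E - Vt t 1) (E - M) (E - m))
  as (l & u & u1 & Hl & H0 & Hul & (s0 & Hs0 & Hu0) & Hd).
- intros t. apply (continuous_minus (V := R_NormedModule) (fun _ => E)).
  + apply continuous_const.
  + now apply continuous_horizontal, Hc.
- lra.
- intros t. specialize (Hm t 1 (Hnz t)). pose proof (proj2 HM t 1 (Hnz t)). lra.
- exists l. split; [exact Hl|]. exists (fun s => RtoC (u s)).
  split; [|split; [|split]].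
  + exists s0. split; [exact Hs0|]. intros H. now apply RtoC_inj in H.
  + now rewrite H0.
  + now rewrite Hul.
  + exists (fun s => RtoC (u1 s)), (fun s => RtoC (- (E - Vt (s / l) 1) * u s)).
    intros s Hs. destruct (Hd s Hs) as [Hu Hu1].
    split; [now apply is_derive_within_RtoC|].
    split; [now apply is_derive_within_RtoC|].
    unfold restriction.
    (* Radial invariance turns [Vt s l] into [Vt (s / l) 1], the potential for which [u] was
       built. *)
    rewrite (radial_projection Vt l s l) by (auto; apply nonzero_r; lra).
    replace (l / l) with 1 by (field; lra).
    rewrite <- RtoC_opp, <- !RtoC_mult, <- RtoC_plus. f_equal. ring.
Qed.
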